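(* For each integer $a\ge 0$, there exists an integer $t_2=t_2(a)$ such that for every integer $t\ge t_2$, there exists a $K_t$-minor-free graph that is not $\{1\star (t-5a-9),\,3\star (2a+3)\}$-choosable.
   Context: All graphs are finite and simple. A graph is $K_t$-minor-free if $K_t$ cannot be obtained from a subgraph of it by contracting edges. A list assignment $L$ of a graph $G$ assigns to each vertex $v$ a set $L(v)$ of colours; an $L$-colouring is a proper colouring $f$ with $f(v)\in L(v)$ for all $v$. For a multiset $\lambda=\{k_1,\dots,k_q\}$ of positive integers, a $\lambda$-list assignment of $G$ is a list assignment $L$ such that the colour set $\bigcup_{v\in V(G)}L(v)$ can be partitioned into $q$ sets $C_1,\dots,C_q$ with $|L(v)\cap C_i|\ge k_i$ for every $i$ and every vertex $v$. $G$ is $\lambda$-choosable if $G$ is $L$-colourable for every $\lambda$-list assignment $L$. The notation $b\star m$ inside a multiset means $m$ copies of $b$; so $\{1\star(t-5a-9),3\star(2a+3)\}$ consists of $t-5a-9$ ones and $2a+3$ threes. *)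

(* Defs.v *)
From mathcomp Require Import all_boot.
Set Implicit Arguments. Unset Strict Implicit. Unset Printing Implicit Defensive.

(* A finite simple graph: vertex set a finType T, adjacency e : rel T that is
   symmetric and irreflexive (these are hypotheses of the theorem). *)

Definition induced_connected (T : finType) (e : rel T) (S : {set T}) : Prop :=
  forall x y, x \in S -> y \in S ->
    connect [rel u v | [&& e u v, u \in S & v \in S]] x y.

Definition has_K_minor (T : finType) (e : rel T) (t : nat) : Prop :=
  exists B : 'I_t -> {set T},
    [/\ forall i, B i != set0,
        forall i, induced_connected e (B i),
        forall i j, i != j -> [disjoint B i & B j] &
        forall i j, i != j -> exists x y, [/\ x \in B i, y \in B j & e x y]].

Definition K_minor_free (T : finType) (e : rel T) (t : nat) : Prop :=
  ~ has_K_minor e t.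

Definition L_colourable (T C : finType) (e : rel T) (L : T -> {set C}) : Prop :=
  exists f : T -> C, (forall v, f v \in L v) /\ (forall u v, e u v -> f u != f v).

(* lam (a multiset of positive integers, given as a list) -list assignment:
   the colours are partitioned into size lam classes (class of colour c is
   part c), and each list has at least (nth 0 lam i) colours in class i. *)
Definition lambda_assignment (T C : finType) (lam : seq nat) (L : T -> {set C}) : Prop :=
  exists part : C -> 'I_(size lam),
    forall v (i : 'I_(size lam)),
      nth 0 lam i <= #|[set c in L v | part c == i]|.

Definition lambda_choosable (T : finType) (e : rel T) (lam : seq nat) : Prop :=
  forall (C : finType) (L : T -> {set C}),
    lambda_assignment lam L -> L_colourable e L.

Definition lam13 (m n : nat) : seq nat := nseq m 1 ++ nseq n 3.

(* Main.v *)
(* Start from a clique K on t - 1 vertices whose lists all consist of the same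
   t + a original colours.  A colouring phi of K uses t - 1 of them, so at least
   a + 2 triples are used completely.  Let M be a set of completely used classes
   with at least a + 2 triples, and attach to K a clique D of a + 2 + #|M|
   vertices.  The list of v in D exchanges one original colour of each class of
   M for a spare one, and v is joined to the vertices of K whose colour is in its
   list.  Only the a + 1 unused original colours and the #|M| spare ones remain
   for D, hence phi does not extend.

   A K_t minor has a branch set inside some D, so every branch set meets D or a
   vertex of K with a neighbour in D.  By counting, some branch set S avoids D
   and contains at most one vertex of each triple of M and no vertex coloured
   outside M.  If every pattern of exchanged colours is repeated often enough in
   D, many vertices of D have no neighbour in S, so the branch sets meeting D
   only in these have to use up vertices of K, and there are fewer than t branch
   sets in total. *)

Require Import Defs.
From mathcomp Require Import all_boot.
From mathcomp Require Import zify.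
Set Implicit Arguments. Unset Strict Implicit. Unset Printing Implicit Defensive.

(** * Disjoint families, connected sets and cardinalities *)

(** Otherwise choosing a point of [Z] in each member would inject [I] into [Z]. *)
Lemma disjoint_family_avoids (I T : finType) (B : I -> {set T}) (Z : {set T}) :
  (forall i j, i != j -> [disjoint B i & B j]) -> #|Z| < #|I| ->
  exists i, [disjoint B i & Z].
Proof.
move=> disB ltZI; apply/existsP; apply: contraT => /existsPn hit.
have [f fP] : exists f : I -> T, forall i, (f i \in B i) && (f i \in Z).
  apply: (@fin_all_exists I (fun=> T) (fun i x => (x \in B i) && (x \in Z))) => i.
  by have /pred0Pn[x xBZ] := hit i; exists x.
have f_inj : injective f.
  move=> i j eqf; have [/andP[fi _] /andP[fj _]] := (fP i, fP j).
  apply/eqP/negPn/negP => /disB /disjointFr /(_ fi).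
  by rewrite eqf fj.
suff leIZ : #|I| <= #|Z| by rewrite ltnNge leIZ in ltZI.
rewrite -(card_codom f_inj).
by apply/subset_leq_card/subsetP => _ /codomP[i ->]; case/andP: (fP i).
Qed.

Lemma induced_connected_exit (T : finType) (e : rel T) (S A : {set T}) x :
  induced_connected e S -> x \in S -> x \in A -> ~~ (S \subset A) ->
  exists u v, [/\ u \in S, v \in S, u \in A, v \notin A & e u v].
Proof.
move=> conS Sx Ax /subsetPn[y Sy nAy].
have /connectP[p] := conS x y Sx Sy.
elim: p x Sx Ax => [|z p IHp] x Sx Ax /=.
  by move=> _ yx; rewrite yx Ax in nAy.
case/andP=> /and3P[exz _ Sz] pth lst.
have [Az|nAz] := boolP (z \in A); first exact: IHp Sz Az pth lst.
by exists x, z.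
Qed.

Lemma subset_of_card (T : finType) (A : {set T}) n :
  n <= #|A| -> exists2 B : {set T}, B \subset A & #|B| = n.
Proof.
elim: n => [|n IHn] lenA; first by exists set0; rewrite ?sub0set ?cards0.
have [B sBA cB] := IHn (ltnW lenA).
have /subsetPn[x Ax nBx] : ~~ (A \subset B).
  by apply/negP => /subset_leq_card; rewrite cB leqNgt lenA.
exists (x |: B); first by rewrite subUset sub1set Ax.
by rewrite cardsU1 nBx cB.
Qed.

Lemma leq1_card_disjoint (T : finType) (A B : {set T}) :
  [disjoint A & B] -> 1 < #|A| -> #|T| <= 3 -> #|B| <= 1.
Proof.
move=> disAB; have := max_card (mem (A :|: B)).
by rewrite cardsU (disjoint_setI0 disAB) cards0; lia.
Qed.

(** * The graph and its lists *)

Section Construction.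

Variables k m q h : nat.

(* The original colours are the single colours of the [m] classes of demand 1
   and the triples of the [q] classes of demand 3; each class moreover has one
   spare colour. *)
Definition orig : finType := ('I_m + 'I_q * 'I_3)%type.
Definition colour : finType := (orig + ('I_m + 'I_q))%type.
Definition pattern : finType := {ffun 'I_q -> 'I_3}.
Definition classes : finType := ({set 'I_m} * {set 'I_q})%type.

(* In every class of [M] one original colour, the one prescribed by the pattern
   [g] in the case of a triple, is exchanged for the spare colour. *)
Definition palette (M : classes) (g : pattern) : {set colour} :=
  [set c : colour | match c with
     | inl (inl i) => i \notin M.1
     | inl (inr (j, x)) => ~~ ((j \in M.2) && (x == g j))
     | inr (inl i) => i \in M.1
     | inr (inr j) => j \in M.2
     end].

Definition precolouring : finType :=
  {f : {ffun 'I_k -> orig} | injectiveb f}.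

Definition full_classes (phi : precolouring) (M : classes) :=
  (forall i, i \in M.1 -> exists u, val phi u = inl i) /\
  (forall j x, j \in M.2 -> exists u, val phi u = inr (j, x)).

(** The clique K on ['I_k], and for each possible colouring [phi] of K its own clique with [h]
    vertices per pattern. *)
Definition vertex : finType := ('I_k + precolouring * (pattern * 'I_h))%type.

Variable M : precolouring -> classes.

Definition adj : rel vertex := fun x y =>
  match x, y with
  | inl u, inl v => u != v
  | inl u, inr (phi, d) => inl (val phi u) \in palette (M phi) d.1
  | inr (phi, d), inl u => inl (val phi u) \in palette (M phi) d.1
  | inr (phi, d), inr (psi, d') => (phi == psi) && (d != d')
  end.

Definition lists (v : vertex) : {set colour} :=
  match v with
  | inl _ => palette (set0, set0) [ffun=> ord0]
  | inr (phi, d) => palette (M phi) d.1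
  end.

Lemma adj_sym : symmetric adj.
Proof.
by move=> [u|[p d]] [v|[p' d']] //=; rewrite eq_sym // [d == d']eq_sym.
Qed.

Lemma adj_irr : irreflexive adj.
Proof. by move=> [u|[p d]] /=; rewrite !eqxx. Qed.

Lemma precolouring_inj (phi : precolouring) : injective (val phi).
Proof. exact/injectiveP/(valP phi). Qed.

(** * Non-colourability from the lists *)

Section NotColourable.

Variable b : nat.
Hypothesis cardM : forall phi,
  #|{: pattern * 'I_h}| = b + #|(M phi).1| + #|(M phi).2|.
Hypothesis few_orig : m + q * 3 < k + b.

Lemma not_L_colourable : ~ L_colourable adj lists.
Proof.
case=> f [fL fadj].
(* The palette of [(set0, set0)] contains no spare colour. *)
have [phi0 phi0P] : exists phi0 : 'I_k -> orig, forall u, f (inl u) = inl (phi0 u).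
  apply: (@fin_all_exists _ (fun=> orig) (fun u o => f (inl u) = inl o)) => u.
  have := fL (inl u); rewrite /= inE.
  by case: (f (inl u)) => [o|[i|j]]; rewrite ?inE //; exists o.
have phi_inj : injectiveb (finfun phi0).
  apply/injectiveP => u v; rewrite !ffunE => eq_uv.
  apply/eqP/negPn/negP => /(fadj (inl u) (inl v)).
  by rewrite !phi0P eq_uv eqxx.
pose phi : precolouring := Sub (finfun phi0) phi_inj.
have phiE u : f (inl u) = inl (val phi u) by rewrite phi0P /= ffunE.
pose im : {set orig} := [set val phi u | u in 'I_k].
pose B : {set colour} := inl @: (~: im) :|:
  (inr @: ([set inl i | i in (M phi).1] :|: [set inr j | j in (M phi).2])).
have cardim : #|im| = k.
  by rewrite card_imset ?card_ord //; apply: precolouring_inj.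
have leB : #|B| <= m + q * 3 - k + (#|(M phi).1| + #|(M phi).2|).
  apply: leq_trans (leq_card_setU _ _) _.
  apply: leq_add; apply: leq_trans (leq_imset_card _ _) _.
    by rewrite cardsCs setCK cardim card_sum card_prod !card_ord.
  apply: leq_trans (leq_card_setU _ _) _.
  by apply: leq_add; apply: leq_imset_card.
pose fD d := f (inr (phi, d)).
have fD_inj : injective fD.
  move=> d d' eqd; apply/eqP/negPn/negP => ndd.
  have := fadj (inr (phi, d)) (inr (phi, d')).
  by rewrite /= eqxx ndd => /(_ isT); rewrite -/(fD d) eqd eqxx.
have subB : [set fD d | d in {: pattern * 'I_h}] \subset B.
  apply/subsetP => _ /imsetP[d _ ->].
  have fLd : fD d \in palette (M phi) d.1 by exact: (fL (inr (phi, d))).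
  have free o : fD d = inl o -> o \notin im.
    move=> fo; apply/negP => /imsetP[u _ ou].
    have := fadj (inl u) (inr (phi, d)).
    by rewrite /= phiE -/(fD d) fo -ou eqxx -fo fLd => /(_ isT).
  rewrite inE; case fd: (fD d) fLd => [o|n] fLd; apply/orP.
    by left; apply: imset_f; rewrite inE free.
  right; apply: imset_f; move: fLd; rewrite !inE.
  by case: (n) => [i|j] iM; apply/orP; [left|right]; apply: imset_f.
have := subset_leq_card subB; rewrite card_imset // (cardM phi) => leD.
(* The subtraction in [leB] is truncated; this bound makes it exact. *)
have : k <= m + q * 3.
  by have := max_card (mem im); rewrite cardim card_sum card_prod !card_ord.
lia.
Qed.

End NotColourable.

(** * Excluding a minor with [k + 1] branch sets *)

Section MinorFree.

Variable b : nat.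
Hypothesis fullM : forall phi, full_classes phi (M phi).
Hypothesis cardM : forall phi,
  #|{: pattern * 'I_h}| = b + #|(M phi).1| + #|(M phi).2|.
Hypothesis bigM : forall phi, b <= #|(M phi).2|.
Hypothesis h_large : b + q <= h.

Variable B : 'I_k.+1 -> {set vertex}.
Hypothesis B_neq0 : forall i, B i != set0.
Hypothesis B_conn : forall i, induced_connected adj (B i).
Hypothesis B_disj : forall i j, i != j -> [disjoint B i & B j].
Hypothesis B_adj : forall i j, i != j ->
  exists x y, [/\ x \in B i, y \in B j & adj x y].

Definition clique_part : {set vertex} := [set inl u | u in 'I_k].
Definition piece (phi : precolouring) : {set vertex} :=
  [set inr (phi, d) | d in {: pattern * 'I_h}].

Lemma in_clique u : inl u \in clique_part.
Proof. exact: imset_f. Qed.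

Lemma in_piece phi d : (inr d \in piece phi) = (d.1 == phi).
Proof.
apply/imsetP/eqP => [[d' _ [->]] //|<-].
by exists d.2 => //; case: d.
Qed.

Lemma inl_piece phi u : (inl u \in piece phi) = false.
Proof. by apply/negP => /imsetP[]. Qed.

Lemma adj_piece phi x y :
  adj x y -> x \in piece phi -> (y \in clique_part) || (y \in piece phi).
Proof.
case: x => [u|[p d]]; first by rewrite inl_piece.
rewrite in_piece => /= adjxy /eqP <-; case: y adjxy => [u|[p' d']] /=.
  by rewrite in_clique.
by rewrite in_piece eq_sym orbC => /andP[->].
Qed.

(** The [k] vertices of K cannot meet all [k + 1] branch sets, and distinct pieces are joined only
    through K. *)
Lemma branch_set_in_piece : exists phi i0, B i0 \subset piece phi.
Proof.
have [|i0 i0K] := disjoint_family_avoids (Z := clique_part) B_disj.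
  by rewrite card_imset ?card_ord // => ? ? [].
have /set0Pn[[u|[phi d]] xB] := B_neq0 i0.
  by have := disjointFr i0K xB; rewrite in_clique.
exists phi, i0; apply/negPn/negP => nsub.
have [|x [y [xBi yBi xP yP xy]]] := induced_connected_exit (@B_conn i0) xB _ nsub.
  by rewrite in_piece.
have := adj_piece xy xP; rewrite (negPf yP) orbF.
by rewrite (disjointFr i0K yBi).
Qed.

Section Piece.

Variable phi : precolouring.

(** Vertices of [swapped1] have no neighbour in the piece, those of [swapped3] miss exactly the
    vertices whose pattern selects their colour, and the other vertices of K see the whole piece. *)
Definition swapped1 : {set 'I_k} :=
  [set u | if val phi u is inl i then i \in (M phi).1 else false].
Definition swapped3 : {set 'I_k} :=
  [set u | if val phi u is inr (j, _) then j \in (M phi).2 else false].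

Lemma card_swapped1 : #|(M phi).1| <= #|swapped1|.
Proof.
rewrite -(card_imset _ (precolouring_inj (phi := phi))).
rewrite -(card_imset _ (@inl_inj 'I_m ('I_q * 'I_3)%type)).
apply/subset_leq_card/subsetP => _ /imsetP[i iM ->].
have [u ui] := (fullM phi).1 i iM.
by rewrite -ui; apply: imset_f; rewrite inE ui.
Qed.

Lemma card_swapped3 : #|(M phi).2| * 3 <= #|swapped3|.
Proof.
rewrite -(card_imset _ (precolouring_inj (phi := phi))).
have -> : #|(M phi).2| * 3 = #|setX (M phi).2 [set: 'I_3]|.
  by rewrite cardsX cardsT card_ord.
rewrite -(card_imset _ (@inr_inj 'I_m ('I_q * 'I_3)%type)).
apply/subset_leq_card/subsetP => o /imsetP[[j x]]; rewrite !inE andbT /= => jM ->.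
have [u uj] := (fullM phi).2 j x jM.
by rewrite -uj; apply: imset_f; rewrite inE uj.
Qed.

Lemma disjoint_swapped : [disjoint swapped1 & swapped3].
Proof.
by rewrite disjoint_subset; apply/subsetP => u; rewrite !inE; case: (val phi u).
Qed.

Lemma card_piece : #|piece phi| = b + #|(M phi).1| + #|(M phi).2|.
Proof. by rewrite card_imset ?cardM // => ? ? []. Qed.

Lemma adj_swapped1 u y : u \in swapped1 -> y \in piece phi -> adj (inl u) y = false.
Proof.
rewrite inE; case: y => [?|[p d]]; first by rewrite inl_piece.
rewrite in_piece /= => + /eqP ->; rewrite inE; case: (val phi u) => // i.
by move=> ->.
Qed.

Definition unswapped : {set vertex} := inl @: ~: (swapped1 :|: swapped3).

Lemma card_unswapped : #|unswapped| + (#|swapped1| + #|swapped3|) = k.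
Proof.
rewrite card_imset; last exact: inl_inj.
have := cardsU swapped1 swapped3.
rewrite (disjoint_setI0 disjoint_swapped) cards0 subn0 => <-.
by rewrite addnC cardsC card_ord.
Qed.

Definition hits i (j : 'I_q) : {set 'I_3} :=
  [set x | [exists u, (inl u \in B i) && (val phi u == inr (j, x))]].

Lemma disjoint_hits i i' j : i != i' -> [disjoint hits i j & hits i' j].
Proof.
move=> /B_disj disB; rewrite disjoint_subset; apply/subsetP => x; rewrite !inE.
case/existsP=> u /andP[uB /eqP ux]; apply/existsPn => u'; apply/negP.
case/andP=> u'B /eqP u'x; have uu' : u = u'.
  by apply: (@precolouring_inj phi); rewrite ux u'x.
by rewrite -uu' (disjointFr disB uB) in u'B.
Qed.

(* Two disjoint branch sets cannot both contain two vertices of one triple, so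
   at most one branch set per triple of [M phi] does. *)
Lemma branch_set_thin : exists i,
  [disjoint B i & unswapped :|: piece phi] /\
  forall j, j \in (M phi).2 -> #|hits i j| <= 1.
Proof.
pose Z := unswapped :|: piece phi.
pose twice i : {set 'I_q} := [set j in (M phi).2 | 1 < #|hits i j|].
(* Each triple of [M phi] that [B i] hits twice is added as an extra point, so one application of
   the counting lemma handles both requirements. *)
pose B' i : {set vertex + 'I_q} :=
  [set z | match z with inl x => x \in B i | inr j => j \in twice i end].
have disB' i i' : i != i' -> [disjoint B' i & B' i'].
  move=> ii'; rewrite disjoint_subset; apply/subsetP => -[x|j].
    by rewrite !inE => /(disjointFr (B_disj ii')) ->.
  rewrite !inE => /andP[jM hij]; rewrite jM /= -leqNgt.
  by apply: leq1_card_disjoint (disjoint_hits j ii') hij _; rewrite card_ord.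
have cardZ : #|inl @: Z :|: inr @: (M phi).2| < #|'I_k.+1|.
  have leZ : #|inl @: Z :|: inr @: (M phi).2|
      <= #|unswapped| + #|piece phi| + #|(M phi).2|.
    apply: leq_trans (leq_card_setU _ _) _.
    by rewrite leq_add ?(leq_trans (leq_imset_card _ _)) ?leq_card_setU.
  rewrite card_ord (leq_ltn_trans leZ) // card_piece.
  (* The total is at most [k + b - #|(M phi).2|], hence at most [k]. *)
  move: (bigM phi) card_swapped1 card_swapped3 card_unswapped; lia.
have [i iZ] := disjoint_family_avoids disB' cardZ.
exists i; split.
  rewrite disjoint_subset; apply/subsetP => x xB; rewrite inE /= -/Z.
  apply: contraFN (disjointFr iZ (x := inl x) _) => [xZ|]; last by rewrite inE.
  by apply/setUP; left; apply: imset_f.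
move=> j jM; rewrite leqNgt; apply/negP => hij.
suff: inr j \in inl @: Z :|: inr @: (M phi).2.
  by rewrite (disjointFr iZ) // !inE jM.
by apply/setUP; right; apply: imset_f.
Qed.

Definition block (g : pattern) : {set vertex} :=
  [set inr (phi, (g, l)) | l in 'I_h].

Lemma card_block g : #|block g| = h.
Proof. by rewrite card_imset ?card_ord // => ? ? []. Qed.

Lemma block_sub_piece g : block g \subset piece phi.
Proof. by apply/subsetP => _ /imsetP[l _ ->]; rewrite in_piece. Qed.

Lemma branch_set_misses_block : exists i g,
  [disjoint B i & unswapped :|: piece phi] /\
  forall x y, x \in B i -> y \in block g -> adj x y = false.
Proof.
have [i [disi thin]] := branch_set_thin.
(* In each triple of [M phi], [g] exchanges the only colour that [B i] can hit. The default [ord0]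
   serves triples that are not hit, where any value will do. *)
pose g : pattern := [ffun j => odflt ord0 [pick x in hits i j]].
exists i, g; split=> // x y xB yg; apply/negP => xy.
have yP := subsetP (block_sub_piece g) _ yg.
have := disjointFr disi xB; rewrite inE => /norP[].
have := adj_piece (etrans (adj_sym y x) xy) yP.
case/orP=> [/imsetP[u _ xu]|->//]; subst x.
rewrite mem_imset; last exact: inl_inj.
rewrite inE negbK inE => /orP[us _|us _]; first by rewrite adj_swapped1 in xy.
case/imsetP: yg xy => l _ -> /=; rewrite inE.
move: us; rewrite inE; case ux: (val phi u) => [//|[j x]] jM.
rewrite jM /=; apply/negP/negPn; rewrite /g ffunE.
have hx : x \in hits i j by rewrite inE; apply/existsP; exists u; rewrite xB ux /=.
case: pickP => [x' hx'|/(_ x)]; last by rewrite hx.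
by apply/eqP; apply: (card_le1_eqP (thin j jM)).
Qed.

End Piece.

(** Some [B i'] meets K only in [swapped1 phi] and the piece only in [block phi g], and no edge
    joins [swapped1 phi] to the piece. By connectivity, [B i'] either lies in the block and is not
    adjacent to [B i], or avoids the block and is not adjacent to [B i0]. *)
Lemma no_branch_sets : False.
Proof.
have [phi [i0 B0P]] := branch_set_in_piece.
have [i [g [iZ ig]]] := branch_set_misses_block phi.
(* By [card_swapped1], [Z] has at most [k + b + #|(M phi).2| - h] elements, which [h_large] bounds
   by [k]. *)
pose Z := (inl @: ~: swapped1 phi) :|: (piece phi :\: block phi g).
have cardZ : #|Z| < #|'I_k.+1|.
  have leZ : #|Z| <= #|~: swapped1 phi| + #|piece phi :\: block phi g|.
    by rewrite (leq_trans (leq_card_setU _ _)) // leq_add2r leq_imset_card.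
  have cP : #|piece phi :\: block phi g| + h = b + #|(M phi).1| + #|(M phi).2|.
    rewrite -card_piece -(card_block phi g) addnC.
    by rewrite -{1}(setIidPr (block_sub_piece phi g)) cardsID.
  have cK : #|swapped1 phi| + #|~: swapped1 phi| = k by rewrite cardsC card_ord.
  have cM : #|(M phi).2| <= q by rewrite -[leqRHS]card_ord max_card.
  rewrite card_ord (leq_ltn_trans leZ) //.
  move: (card_swapped1 phi) cP cK cM h_large; lia.
have [i' i'Z] := disjoint_family_avoids B_disj cardZ.
have i'K u : inl u \in B i' -> u \in swapped1 phi.
  move=> /(disjointFr i'Z); rewrite inE => /norP[+ _].
  by rewrite mem_imset ?inE ?negbK //; apply: inl_inj.
have i'P x : x \in B i' -> x \in piece phi -> x \in block phi g.
  move=> /(disjointFr i'Z); rewrite inE => /norP[_].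
  by rewrite inE => + xP; rewrite xP andbT negbK.
have [sub|nsub] := boolP (B i' \subset block phi g).
  have ii' : i != i'.
    apply: contraTneq sub => <-; have /set0Pn[x xB] := B_neq0 i.
    apply/subsetPn; exists x => //; apply: contraFN (disjointFr iZ xB) => xg.
    by rewrite inE (subsetP (block_sub_piece phi g)) ?orbT.
  have [x [y [xB yB xy]]] := B_adj ii'.
  by rewrite ig ?(subsetP sub) in xy.
have [/pred0P meet|/pred0Pn[x /andP[xB xg]]] :=
    boolP [disjoint B i' & block phi g].
  have i'0 : i' != i0.
    have /set0Pn[x xB] := B_neq0 i0; apply/eqP => eqi.
    have xP := subsetP B0P x xB; rewrite -eqi in xB.
    by have := meet x; rewrite /= xB i'P.
  have [x [y [xB yB xy]]] := B_adj i'0.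
  have yP := subsetP B0P y yB.
  have := adj_piece (etrans (adj_sym y x) xy) yP.
  case/orP=> [/imsetP[u _ xu]|xP]; last by have := meet x; rewrite /= xB i'P.
  by move: xB xy; rewrite xu => /i'K uS; rewrite (adj_swapped1 uS yP).
have [x1 [y [_ yB x1g nyg xy]]] := induced_connected_exit (@B_conn i') xB xg nsub.
have x1P := subsetP (block_sub_piece phi g) x1 x1g.
case/orP: (adj_piece xy x1P) => [/imsetP[u _ yu]|yP].
  by move: yB xy; rewrite yu adj_sym => /i'K uS; rewrite (adj_swapped1 uS x1P).
by rewrite i'P in nyg.
Qed.

End MinorFree.

(** * The lists meet the demands of all classes *)

Lemma lists_lambda_assignment : lambda_assignment (lam13 m q) lists.
Proof.
have sz : m + q = size (lam13 m q) by rewrite size_cat !size_nseq.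
pose part (c : colour) : 'I_(size (lam13 m q)) := cast_ord sz
  match c with
  | inl (inl i) | inr (inl i) => lshift q i
  | inl (inr (j, _)) | inr (inr j) => rshift m j
  end.
have palP (N : classes) g (i : 'I_(size (lam13 m q))) :
    nth 0 (lam13 m q) i <= #|[set c in palette N g | part c == i]|.
  rewrite -[i](cast_ordKV sz); case: (split_ordP (cast_ord (esym sz) i)) => j ->.
    rewrite /= nth_cat size_nseq ltn_ord nth_nseq ltn_ord card_gt0.
    apply/set0Pn; exists (if j \in N.1 then inr (inl j) else inl (inl j)).
    by rewrite !inE; case: ifP => /= [->|->]; rewrite eqxx.
  rewrite /= nth_cat size_nseq ltnNge leq_addr /= addKn nth_nseq ltn_ord.
  (* The three colours of triple [j] in the palette, with the spare in place of the exchanged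
     one. *)
  pose c x : colour :=
    if (j \in N.2) && (x == g j) then inr (inr j) else inl (inr (j, x)).
  have c_inj : injective c.
    move=> x y; rewrite /c; case: andP => [[_ /eqP->]|_]; case: andP => [[_ /eqP->]|_] //.
    by case.
  have card3 : #|c @: [set: 'I_3]| = 3 by rewrite card_imset // cardsT card_ord.
  rewrite -{1}card3.
  apply/subset_leq_card/subsetP => _ /imsetP[x _ ->]; rewrite !inE /c.
  by case: ifP => [/andP[-> _]|] /=; rewrite ?eqxx ?andbT // => ->.
exists part => -[u|[phi d]] i; exact: palP.
Qed.

End Construction.

(** * Choice of the exchanged classes and of the parameters *)

(** Take all completely used triples and fill up with used single colours to [s - b] classes, [s]
    being the prescribed size of the attached clique. *)
Lemma full_classes_exist k m q b s (phi : precolouring k m q) :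
  m + q * 2 + b <= k -> b + q <= s -> s + q * 3 <= k ->
  exists M : classes m q,
    [/\ full_classes phi M, s = b + #|M.1| + #|M.2| & b <= #|M.2|].
Proof.
move=> lek les ltk; pose im : {set orig m q} := [set val phi u | u in 'I_k].
have cardim : #|im| = k.
  by rewrite card_imset ?card_ord //; apply: precolouring_inj.
pose F1 : {set 'I_m} := [set i | inl i \in im].
pose F2 : {set 'I_q} := [set j | [forall x, inr (j, x) \in im]].
have F1_large : k <= #|F1| + q * 3.
  have sub : im \subset inl @: F1 :|: inr @: [set: 'I_q * 'I_3].
    apply/subsetP => -[i|jx] oim; rewrite inE; apply/orP.
      by left; apply: imset_f; rewrite inE.
    by right; apply: imset_f; rewrite inE.
  rewrite -cardim; apply: leq_trans (subset_leq_card sub) _.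
  apply: leq_trans (leq_card_setU _ _) _; apply: leq_add; first exact: leq_imset_card.
  by rewrite (leq_trans (leq_imset_card _ _)) // cardsT card_prod !card_ord.
have F2_large : b <= #|F2|.
  have [miss missP] : exists miss : 'I_q -> 'I_3,
      forall j, j \notin F2 -> inr (j, miss j) \notin im.
    apply: (@fin_all_exists _ (fun=> 'I_3)
      (fun j x => j \notin F2 -> inr (j, x) \notin im)) => j.
    have [jF|] := boolP (j \in F2); first by exists ord0.
    by rewrite inE => /forallPn[x nx]; exists x.
  have sub : [set inr (j, miss j) | j in ~: F2] \subset ~: im.
    by apply/subsetP => _ /imsetP[j jF ->]; rewrite inE missP // -in_setC.
  have leC : #|~: F2| <= #|~: im|.
    by move: (subset_leq_card sub); rewrite card_imset // => ? ? [].
  have cF : #|F2| + #|~: F2| = q by rewrite cardsC card_ord.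
  have cI : k + #|~: im| = m + q * 3.
    by rewrite -{1}cardim cardsC card_sum card_prod !card_ord.
  lia.
have F2_small : #|F2| <= q by have := max_card (mem F2); rewrite card_ord.
have [|M1 sub cM1] := @subset_of_card _ F1 (s - b - #|F2|); first lia.
have lebF : b + #|F2| <= s by lia.
exists (M1, F2); split=> //=; last by rewrite cM1 -subnDA addnAC subnKC.
split=> [i /(subsetP sub)|j x]; rewrite inE.
  by case/imsetP=> u _ ->; exists u.
by move/forallP/(_ x) => /imsetP[u _ ->]; exists u.
Qed.

Theorem theorem3 :
  forall a : nat, exists t2 : nat, forall t : nat, t2 <= t ->
    exists (T : finType) (e : rel T),
      [/\ symmetric e, irreflexive e, K_minor_free e t &
          ~ lambda_choosable e (lam13 (t - 5 * a - 9) (2 * a + 3))].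
Proof.
move=> a; pose q := 2 * a + 3; pose h := a + 2 + q.
pose s := #|{: pattern q * 'I_h}|.
have les : h <= s.
  rewrite /s card_prod card_ord leq_pmull //; apply/card_gt0P.
  by exists [ffun=> ord0].
exists (s + q * 3 + 1) => t let2; pose m := t - 5 * a - 9; pose k := t.-1.
(* Since [t >= 5 * a + 9], the subtraction in [m] is exact, so [m + q * 3 = t + a] and
   [m + q * 2 + (a + 2) = t - 1]: the first and third bounds have no slack. *)
have [lek ltk few tk] : [/\ m + q * 2 + (a + 2) <= k, s + q * 3 <= k,
    m + q * 3 < k + (a + 2) & t = k.+1].
  by move: let2 les; rewrite /k /m /h /q; clearbody s => *; split; lia.
have [M MP] : exists M : precolouring k m q -> classes m q, forall phi,
    [/\ full_classes phi (M phi), s = a + 2 + #|(M phi).1| + #|(M phi).2|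
      & a + 2 <= #|(M phi).2|].
  apply: (@fin_all_exists _ (fun=> classes m q) (fun phi N =>
    [/\ full_classes phi N, s = a + 2 + #|N.1| + #|N.2| & a + 2 <= #|N.2|])).
  by move=> phi; apply: full_classes_exist.
have fullM phi : full_classes phi (M phi) by case: (MP phi).
have cardM phi : s = a + 2 + #|(M phi).1| + #|(M phi).2| by case: (MP phi).
have bigM phi : a + 2 <= #|(M phi).2| by case: (MP phi).
exists (vertex k m q h), (adj M); split.
- exact: adj_sym.
- exact: adj_irr.
- rewrite tk; case=> B [B0 Bc Bd Ba].
  exact: (no_branch_sets fullM cardM bigM (leqnn _) B0 Bc Bd Ba).
- move=> choosable; apply: (not_L_colourable cardM few).
  exact/choosable/lists_lambda_assignment.
Qed.
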